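(* Let $a\in\mathbb{C}^\times$ and let $f(x)=\frac{1}{a}(e^{ax}-1)\in\mathbb{C}[[x]]$. Let $(b_j)_{j\geq 1}$ be the unique sequence of complex numbers such that $$\cdots\exp\left(b_3x^4\frac{d}{dx}\right)\exp\left(b_2x^3\frac{d}{dx}\right)\exp\left(b_1x^2\frac{d}{dx}\right)\cdot x=f(x).$$ Then $b_1=\frac{a}{2}$ and $b_j=0$ for all odd $j>1$.
   Context: All series are formal power series in $x$. The operators $x^{j+1}\frac{d}{dx}$, $j\geq 1$, on $\mathbb{C}[[x]]$ raise degrees of monomials by $j$, so the infinite product (extending to the left, the factor with index $1$ acting first) is a well-defined operator on $\mathbb{C}[[x]]$: the coefficient of $x^{n+1}$ in the result of applying it to $x$ depends only on the rightmost $n$ factors. For every series $f(x)=x+\sum_{n\geq 2}a_nx^n$ with complex coefficients, the sequence $(b_j)_{j\geq1}$ exists and is unique. *)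

(* Defs.v *)
From mathcomp Require Import all_boot all_order all_algebra.
From mathcomp Require Import boolp classical_sets reals.
From mathcomp Require Export complex.
Set Implicit Arguments.
Unset Strict Implicit.
Unset Printing Implicit Defensive.
Import GRing.Theory.
Local Open Scope ring_scope.

(* A formal power series over K is its sequence of coefficients. *)
Definition fps (K : Type) := nat -> K.

Section FormalPowerSeries.
Variable K : numFieldType.
Implicit Types (f g : fps K) (u : nat -> fps K) (A : fps K -> fps K).

Definition fps1 : fps K := fun n => (n == 0%N)%:R.
Definition fpsX : fps K := fun n => (n == 1%N)%:R.
Definition fps_sub f g : fps K := fun n => f n - g n.
Definition fps_scale (c : K) f : fps K := fun n => c * f n.
Definition fps_mulXn (k : nat) f : fps K :=
  fun n => if (n < k)%N then 0 else f (n - k)%N.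
Definition fps_deriv f : fps K := fun n => n.+1%:R * f n.+1.

(* e^(a x) *)
Definition fps_exp (a : K) : fps K := fun n => a ^+ n / n`!%:R.

(* Convergence in the x-adic topology: every coefficient is eventually
   constant. *)
Definition fps_cvg u f := forall n : nat, exists N : nat,
  forall m : nat, (N <= m)%N -> u m n = f n.

Definition fps_lim u : fps K := fun n =>
  xget 0 [set c : K | exists N : nat, forall m : nat, (N <= m)%N -> u m n = c]%classic.

Definition exp_partial A (m : nat) g : fps K :=
  fun n => \sum_(k < m) (k`!%:R)^-1 * iter k A g n.

(* exp(A) g = sum over k of A^k g / k!; meaningful when this series converges
   x-adically, which is the case for the operators below (exp_vfield_cvg). *)
Definition op_exp A g : fps K := fps_lim (fun m => exp_partial A m g).

(* The operator c x^(j+1) d/dx. *)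
Definition vfield (c : K) (j : nat) g : fps K :=
  fps_scale c (fps_mulXn j.+1 (fps_deriv g)).

(* exp(b_N x^(N+1) d/dx) ... exp(b_1 x^2 d/dx) g; the value b 0 is not used. *)
Fixpoint exp_prod (b : nat -> K) (N : nat) g : fps K :=
  if N is N'.+1 then op_exp (vfield (b N) N) (exp_prod b N' g) else g.

(* ... exp(b_3 x^4 d/dx) exp(b_2 x^3 d/dx) exp(b_1 x^2 d/dx) g = f *)
Definition inf_exp_prod_eq (b : nat -> K) g f :=
  fps_cvg (fun N => exp_prod b N g) f.

Lemma fps_limE u f : fps_cvg u f -> fps_lim u = f.
Proof.
move=> uf; apply/funext => n; rewrite /fps_lim.
have [N hN] := uf n.
case: xgetP => [c _ [M hM]|/(_ (f n)) []]; last by exists N.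
by rewrite -(hM (maxn M N)) ?leq_maxl // hN ?leq_maxr.
Qed.

Lemma vfieldE c j g n :
  vfield c j g n = if (n <= j)%N then 0 else c * ((n - j)%:R * g (n - j)%N).
Proof.
rewrite /vfield /fps_scale /fps_mulXn /fps_deriv ltnS.
case: leqP => [_|jn]; first by rewrite mulr0.
by rewrite -subSn // subSS.
Qed.

Lemma iter_vfield0 c j g k n :
  (0 < j)%N -> (0 < k)%N -> (n < j + k)%N -> iter k (vfield c j) g n = 0.
Proof.
move=> j0; elim: k n => // -[|k] IH n _ nk; rewrite iterS vfieldE.
  by rewrite addn1 ltnS in nk; rewrite nk.
case: leqP => // jn; rewrite IH ?mulr0 //.
by rewrite ltn_subLR ?(ltnW jn) // (leq_trans nk) // leq_add2l -add1n leq_add2r.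
Qed.

Lemma exp_partial_vfieldE c j g m n : (0 < j)%N -> (n < m)%N ->
  exp_partial (vfield c j) m g n = exp_partial (vfield c j) n.+1 g n.
Proof.
move=> j0; elim: m => // m IH; rewrite ltnS leq_eqVlt => /predU1P[->//|nm].
rewrite {1}/exp_partial big_ord_recr /= -/(exp_partial _ m g n) IH //.
rewrite iter_vfield0 ?mulr0 ?addr0 //; first exact: leq_ltn_trans nm.
by rewrite (leq_trans nm) // leq_addl.
Qed.

Lemma exp_vfield_cvg c j g : (0 < j)%N ->
  fps_cvg (fun m => exp_partial (vfield c j) m g) (op_exp (vfield c j) g).
Proof.
move=> j0; pose f n := exp_partial (vfield c j) n.+1 g n.
suff uf : fps_cvg (fun m => exp_partial (vfield c j) m g) f.
  by rewrite /op_exp (fps_limE uf).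
by move=> n; exists n.+1 => m nm; exact: exp_partial_vfieldE.
Qed.

Lemma op_exp_vfieldE c j g n : (0 < j)%N ->
  op_exp (vfield c j) g n =
  \sum_(k < n.+1) (k`!%:R)^-1 * iter k (vfield c j) g n.
Proof.
move=> j0; have [N hN] := exp_vfield_cvg c g j0 n.
by rewrite -(hN (maxn N n.+1)) ?leq_maxl // exp_partial_vfieldE // leq_maxr.
Qed.

Lemma op_exp_vfield_low c j g n : (0 < j)%N -> (n <= j)%N ->
  op_exp (vfield c j) g n = g n.
Proof.
move=> j0 nj; rewrite op_exp_vfieldE // big_ord_recl /= fact0 invr1 mul1r.
rewrite big1 ?addr0 // => i _; rewrite -iterS iter_vfield0 ?mulr0 //.
by rewrite addnS ltnS (leq_trans nj) // leq_addr.
Qed.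

Lemma op_exp_vfield_next c j g : (0 < j)%N ->
  op_exp (vfield c j) g j.+1 = g j.+1 + c * g 1%N.
Proof.
move=> j0; rewrite op_exp_vfieldE // !big_ord_recl /= /bump /= fact0 (_ : (1 + 0)`! = 1)%N //.
rewrite invr1 !mul1r vfieldE ltnn subSnn mul1r.
rewrite big1 ?addr0 // => i _; rewrite -!iterS iter_vfield0 ?mulr0 //.
by rewrite !addnS !ltnS leq_addr.
Qed.

Lemma exp_prod_stable b g N n : (n <= N.+1)%N ->
  exp_prod b N g n = exp_prod b n.-1 g n.
Proof.
elim: N => [|N IH]; first by case: n => [|[]].
rewrite leq_eqVlt => /predU1P[->//|]; rewrite ltnS => nN.
by rewrite /= op_exp_vfield_low // IH.
Qed.

Lemma exp_prod_cvgE b g f :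
  inf_exp_prod_eq b g f <-> forall n, f n = exp_prod b n.-1 g n.
Proof.
split=> [h n|h n]; last first.
  by exists n => m nm; rewrite h exp_prod_stable // leqW.
have [N hN] := h n.
by rewrite -(hN (maxn N n)) ?leq_maxl // exp_prod_stable // leqW // leq_maxr.
Qed.

Lemma exp_prodX1 b N : exp_prod b N fpsX 1%N = 1.
Proof. by rewrite exp_prod_stable. Qed.

Lemma inf_exp_prod_exists f : f 0%N = 0 -> f 1%N = 1 ->
  exists b, inf_exp_prod_eq b fpsX f.
Proof.
move=> f0 f1.
pose step N g := op_exp (vfield (f N.+2 - g N.+2) N.+1) g.
pose G := fix G N := if N is M.+1 then step M (G M) else fpsX.
pose b n := f n.+1 - G n.-1 n.+1.
have GE N : exp_prod b N fpsX = G N by elim: N => //= N ->.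
exists b; apply/exp_prod_cvgE => -[|[|n]] //=; rewrite ?f0 ?f1 //.
by rewrite op_exp_vfield_next // exp_prodX1 mulr1 GE /b /= addrC subrK.
Qed.

Lemma inf_exp_prod_unique f b b' :
  inf_exp_prod_eq b fpsX f -> inf_exp_prod_eq b' fpsX f ->
  forall j, (0 < j)%N -> b j = b' j.
Proof.
move=> /exp_prod_cvgE h /exp_prod_cvgE h'.
have E N : exp_prod b N fpsX = exp_prod b' N fpsX /\ b N.+1 = b' N.+1.
  elim: N => [|N [IH bN]].
    split=> //; have := h 2%N; rewrite h' /= !op_exp_vfield_next //=.
    by rewrite !mulr1 => /addrI ->.
  have EN : exp_prod b N.+1 fpsX = exp_prod b' N.+1 fpsX by rewrite /= IH bN.
  split=> //; have := h N.+3; rewrite h' /=.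
  rewrite !op_exp_vfield_next // -/(exp_prod b N.+1 _) -/(exp_prod b' N.+1 _).
  by rewrite EN !exp_prodX1 !mulr1 => /addrI ->.
by case=> // j _; case: (E j).
Qed.

End FormalPowerSeries.

Arguments fps1 {K}.
Arguments fpsX {K}.

(* Main.v *)
Require Import Defs.
From mathcomp Require Import all_boot all_order all_algebra reals.
From mathcomp Require Import boolp ring.
Import GRing.Theory Num.Theory.
Local Open Scope ring_scope.

(** Let s be the substitution x -> -x. It conjugates exp(c x^(j+1) d/dx) into
    exp((-1)^j c x^(j+1) d/dx). For u = x/(1 - (a/2) x) and for u = f, the
    series u and v = s(u) satisfy u + v + a u v = 0, which determines u from v.
    The operators exp(c x^(j+1) d/dx) are multiplicative, so replacing b_j by
    (-1)^j b_j for j > 1 in the product turns x into a series u such that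
    u + s(f) + a u s(f) = 0, hence u = f. By uniqueness of the exponents,
    b_j = (-1)^j b_j for all j > 1. *)

Section CauchyProduct.
Set Implicit Arguments.
Unset Strict Implicit.
Context {K : numFieldType}.
Implicit Types (f g h u v : fps K) (a c : K).

(** * The Cauchy product and the Leibniz rule *)

Definition fps_mul f g : fps K := fun n => \sum_(i < n.+1) f i * g (n - i)%N.

Lemma fps_mulC f g : fps_mul f g = fps_mul g f.
Proof.
apply/funext => n; rewrite /fps_mul (reindex_inj rev_ord_inj) /=.
by apply: eq_bigr => i _; rewrite subSS subKn 1?mulrC // -ltnS.
Qed.

Lemma eq_fps_mul f f' g g' n :
    (forall i, (i <= n)%N -> f i = f' i) ->
    (forall i, (i <= n)%N -> g i = g' i) ->
  fps_mul f g n = fps_mul f' g' n.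
Proof.
by move=> ff gg; apply: eq_bigr => i _; rewrite ff ?gg ?leq_subr // -ltnS.
Qed.

Lemma fps_mul_eq0 f g k l n :
    (forall i, (i < k)%N -> f i = 0) -> (forall i, (i < l)%N -> g i = 0) ->
  (n < k + l)%N -> fps_mul f g n = 0.
Proof.
move=> f0 g0 nkl; rewrite /fps_mul big1 // => i _.
have [ik|ki] := ltnP i k; first by rewrite f0 ?mul0r.
have iln : (i <= n)%N by rewrite -ltnS.
by rewrite g0 ?mulr0 // ltn_subLR // (leq_trans nkl) // leq_add2r.
Qed.

Lemma vfield_low c j f n : (n < j)%N -> vfield c j f n = 0.
Proof. by rewrite vfieldE => /ltnW ->. Qed.

Lemma vfieldD c j f n : vfield c j f (j + n)%N = c * (n%:R * f n).
Proof.
rewrite vfieldE addKn; case: leqP => //.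
by case: n => [|n]; rewrite ?mul0r ?mulr0 // addnS ltnNge leq_addr.
Qed.

Lemma fps_mul_vfieldl c j f g n :
  fps_mul (vfield c j f) g (j + n)%N =
  \sum_(i < n.+1) c * (i%:R * f i) * g (n - i)%N.
Proof.
rewrite /fps_mul -addnS big_split_ord /= big1 ?add0r => [|i _].
  by apply: eq_bigr => i _; rewrite vfieldD subnDl.
by rewrite vfield_low ?mul0r.
Qed.

Lemma vfield_mul c j f g n :
  vfield c j (fps_mul f g) n =
  fps_mul (vfield c j f) g n + fps_mul f (vfield c j g) n.
Proof.
have [nj|jn] := ltnP n j.
  rewrite vfield_low //.
  rewrite (@fps_mul_eq0 _ _ j 0) ?addn0 //; last exact: vfield_low.
  by rewrite (@fps_mul_eq0 _ _ 0 j) ?addr0 //; exact: vfield_low.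
rewrite -(subnKC jn); set m := (n - j)%N.
rewrite (fps_mulC f (vfield c j g)) !fps_mul_vfieldl vfieldD /fps_mul.
(* Reversing the second sum aligns both sums on [i]; the weight then splits as m = i + (m - i). *)
rewrite [X in _ = _ + X](reindex_inj rev_ord_inj) /= -big_split /= !mulr_sumr.
apply: eq_bigr => i _; have im : (i <= m)%N by rewrite -ltnS.
rewrite subSS subKn // -{1}(subnKC im) natrD.
ring.
Qed.

(** * Exponentials of vector fields as algebra endomorphisms *)

(* With divided powers D^k / k! the iterated Leibniz rule has no binomials. *)
Definition vfield_dp c j k f : fps K := fun n => k`!%:R^-1 * iter k (vfield c j) f n.

Lemma vfield_dp0 c j f : vfield_dp c j 0 f = f.
Proof. by apply/funext => n; rewrite /vfield_dp fact0 invr1 mul1r. Qed.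

Lemma vfield_dpS c j k f n :
  k.+1%:R * vfield_dp c j k.+1 f n = vfield c j (vfield_dp c j k f) n.
Proof.
rewrite /vfield_dp iterS factS natrM !vfieldE.
case: leqP => _; first by rewrite !mulr0.
have k1 : k.+1%:R != 0 :> K by rewrite pnatr_eq0.
have k2 : k`!%:R != 0 :> K by rewrite pnatr_eq0 -lt0n fact_gt0.
by field; rewrite ?nat1r ?k1 ?k2.
Qed.

Lemma vfield_dp_low c j k f n : (0 < j)%N -> (n < k)%N ->
  vfield_dp c j k f n = 0.
Proof.
move=> j0 nk; rewrite /vfield_dp iter_vfield0 ?mulr0 //.
  exact: leq_ltn_trans nk.
by rewrite (leq_trans nk) // leq_addl.
Qed.

Lemma vfield_sum c j k (F : 'I_k -> fps K) n :
  vfield c j (fun m => \sum_(i < k) F i m) n = \sum_(i < k) vfield c j (F i) n.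
Proof.
under eq_bigr do rewrite vfieldE.
rewrite vfieldE; case: leqP => _; first by rewrite big1.
by rewrite -!mulr_sumr.
Qed.

(** Induction on [k], after multiplying by [k.+1]: differentiating the left and right factors yields
    sums of the terms [T i] with weights [i] and [k.+1 - i], which add up to [k.+1]. *)
Lemma vfield_dp_mul c j k f g n :
  vfield_dp c j k (fps_mul f g) n =
  \sum_(i < k.+1) fps_mul (vfield_dp c j i f) (vfield_dp c j (k - i) g) n.
Proof.
elim: k n => [|k IH] n; first by rewrite big_ord1 !vfield_dp0.
have k1 : k.+1%:R != 0 :> K by rewrite pnatr_eq0.
apply: (mulfI k1); rewrite vfield_dpS.
rewrite (funext IH : vfield_dp c j k (fps_mul f g) = _) vfield_sum.
under eq_bigr => i _ do rewrite vfield_mul.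
rewrite big_split /=.
have scalel p u v : fps_mul (fun m => p * u m) v n = p * fps_mul u v n.
  by rewrite /fps_mul mulr_sumr; apply: eq_bigr => i _; rewrite mulrA.
have dpE l u : vfield c j (vfield_dp c j l u) =
    fun m => l.+1%:R * vfield_dp c j l.+1 u m.
  by apply/funext => m; rewrite vfield_dpS.
pose T i := fps_mul (vfield_dp c j i f) (vfield_dp c j (k.+1 - i) g) n.
have -> : \sum_(i < k.+1)
    fps_mul (vfield c j (vfield_dp c j i f)) (vfield_dp c j (k - i) g) n =
    \sum_(i < k.+2) i%:R * T i.
  rewrite [RHS]big_ord_recl mul0r add0r; apply: eq_bigr => i _.
  by rewrite dpE scalel /T /= /bump /= add1n subSS.
have -> : \sum_(i < k.+1)
    fps_mul (vfield_dp c j i f) (vfield c j (vfield_dp c j (k - i) g)) n =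
    \sum_(i < k.+2) (k.+1 - i)%:R * T i.
  rewrite [RHS]big_ord_recr /= subnn mul0r addr0; apply: eq_bigr => i _.
  have ik : (i <= k)%N by rewrite -ltnS.
  by rewrite dpE fps_mulC scalel fps_mulC /T subSn.
rewrite -big_split mulr_sumr; apply: eq_bigr => i _ /=.
by rewrite -mulrDl -natrD subnKC // -ltnS.
Qed.

Lemma op_exp_vfield_dpE c j f n N : (0 < j)%N -> (n < N)%N ->
  op_exp (vfield c j) f n = \sum_(k < N) vfield_dp c j k f n.
Proof.
move=> j0 nN; rewrite op_exp_vfieldE //.
exact/esym/exp_partial_vfieldE.
Qed.

(** The i-th divided power of a series starts in degree at least i. In degree n, the square of terms
    from the product of two exponentials thus reduces to the triangle i + l <= n, which is what the
    Leibniz rule produces. *)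
Lemma op_exp_vfield_mul c j f g n : (0 < j)%N ->
  op_exp (vfield c j) (fps_mul f g) n =
  fps_mul (op_exp (vfield c j) f) (op_exp (vfield c j) g) n.
Proof.
move=> j0; rewrite (@op_exp_vfield_dpE _ _ _ _ n.+1) //.
pose T i l := fps_mul (vfield_dp c j i f) (vfield_dp c j l g) n.
have T0 i l : (n < i + l)%N -> T i l = 0.
  by apply: fps_mul_eq0 => m; exact: vfield_dp_low.
transitivity (\sum_(i < n.+1) \sum_(l < n.+1) T i l); last first.
  transitivity (fps_mul (fun m => \sum_(i < n.+1) vfield_dp c j i f m)
                        (fun m => \sum_(i < n.+1) vfield_dp c j i g m) n).
    rewrite /T /fps_mul.
    under eq_bigr do rewrite exchange_big /=.
    rewrite exchange_big /=; apply: eq_bigr => m _.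
    rewrite mulr_suml; apply: eq_bigr => i _.
    by rewrite mulr_sumr.
  by apply: eq_fps_mul => i iln; rewrite (@op_exp_vfield_dpE _ _ _ _ n.+1).
under eq_bigr => k _ do rewrite vfield_dp_mul.
transitivity (\sum_(k < n.+1) \sum_(i < n.+1 | (i <= k)%N) T i (k - i)%N).
  apply: eq_bigr => k _.
  by rewrite (big_ord_widen n.+1 (fun i => T i (k - i)%N)).
(* For fixed i, k runs from i to n and l = k - i from 0 to n - i; extending the range to l <= n adds
   only zeros, by [T0]. *)
rewrite (exchange_big_dep predT) //=; apply: eq_bigr => i _.
have iln : (i <= n)%N by rewrite -ltnS.
rewrite -(big_mkord (fun k => i <= k)%N (fun k => T i (k - i)%N)).
rewrite (big_cat_nat (leq0n i)) //=; last exact: leqW.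
rewrite big_nat_cond big1 ?add0r; last first.
  by move=> k /andP[/andP[_ ki]]; rewrite leqNgt ki.
rewrite -{1}[nat_of_ord i]add0n big_addn.
under eq_bigl do rewrite leq_addl.
under eq_bigr do rewrite addnK.
rewrite subSn // big_mkord.
rewrite (big_ord_widen n.+1 (T i)) ?ltnS ?leq_subr //.
rewrite [RHS](bigID (fun l : 'I_n.+1 => (l < (n - i).+1)%N)) /=.
rewrite [X in _ = _ + X]big1 ?addr0 // => l.
by rewrite -leqNgt => nil; rewrite T0 // -ltn_subLR.
Qed.

Lemma op_exp_vfield0 c j n : (0 < j)%N ->
  op_exp (vfield c j) (fun=> 0) n = 0.
Proof.
move=> j0; rewrite op_exp_vfieldE // big1 // => k _.
suff -> : iter k (vfield c j) (fun=> 0) n = 0 by rewrite mulr0.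
move: (nat_of_ord k) => {}k; elim: k n => // k IH n; rewrite iterS vfieldE IH !mulr0.
by case: leqP.
Qed.

Lemma op_exp_vfieldD c j f g n : (0 < j)%N ->
  op_exp (vfield c j) (fun m => f m + g m) n =
  op_exp (vfield c j) f n + op_exp (vfield c j) g n.
Proof.
move=> j0; rewrite !op_exp_vfieldE // -big_split; apply: eq_bigr => k _ /=.
suff -> : iter k (vfield c j) (fun m => f m + g m) n =
  iter k (vfield c j) f n + iter k (vfield c j) g n by rewrite mulrDr.
move: (nat_of_ord k) => {}k; elim: k n => // k IH n; rewrite !iterS !vfieldE IH.
by case: leqP; rewrite ?addr0 // !mulrDr.
Qed.

Lemma op_exp_vfieldZ c j a f n : (0 < j)%N ->
  op_exp (vfield c j) (fps_scale a f) n = a * op_exp (vfield c j) f n.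
Proof.
move=> j0; rewrite !op_exp_vfieldE // mulr_sumr; apply: eq_bigr => k _ /=.
suff -> : iter k (vfield c j) (fps_scale a f) n =
  a * iter k (vfield c j) f n by rewrite mulrCA.
move: (nat_of_ord k) => {}k; elim: k n => // k IH n; rewrite !iterS !vfieldE IH.
by case: leqP; rewrite ?mulr0 // => _; ring.
Qed.

(** * The substitution x -> -x and the relation u + v + a u v = 0 *)

Definition fps_flip f : fps K := fun n => (-1) ^+ n * f n.

(** The field shifts degrees by j, so moving the flip past one application of it costs a factor
    (-1)^j. *)
Lemma op_exp_vfield_flip c j f : (0 < j)%N ->
  fps_flip (op_exp (vfield c j) f) =
  op_exp (vfield ((-1) ^+ j * c) j) (fps_flip f).
Proof.
move=> j0; apply/funext => n; rewrite /fps_flip !op_exp_vfieldE // mulr_sumr.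
apply: eq_bigr => k _; rewrite mulrCA; congr (_ * _).
move: (nat_of_ord k) => {}k; elim: k n => // k IH n; rewrite !iterS !vfieldE -IH.
case: leqP => [|jn]; first by rewrite mulr0.
by rewrite -{1}(subnKC (ltnW jn)) exprD; ring.
Qed.

(* u and v are exchanged by the involution y |-> - y / (1 + a y). *)
Definition moebius_rel a u v n : Prop := u n + v n + a * fps_mul u v n = 0.

(** The exponential is linear and multiplicative, so it can be applied to the identity u + v + a u v
    = 0 itself. *)
Lemma moebius_rel_op_exp a u v c j : (0 < j)%N ->
  (forall n, moebius_rel a u v n) ->
  forall n, moebius_rel a (op_exp (vfield c j) u) (op_exp (vfield c j) v) n.
Proof.
move=> j0 uv n; rewrite /moebius_rel -op_exp_vfield_mul // -op_exp_vfieldZ //.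
rewrite -!op_exp_vfieldD // -[RHS](op_exp_vfield0 c n j0).
congr (op_exp _ _ _); apply/funext => m; exact: uv.
Qed.

(** Since v has no constant term, the coefficient of x^n in u v involves only the u_i with i < n,
    and the relation determines u_n recursively. The bound [N] allows for partial products, which
    agree with their limit only up to a finite degree. *)
Lemma moebius_rel_inj a u u' v v' N : v 0%N = 0 ->
    (forall n, (n <= N)%N -> v n = v' n) ->
    (forall n, moebius_rel a u v n) -> (forall n, moebius_rel a u' v' n) ->
  forall n, (n <= N)%N -> u n = u' n.
Proof.
move=> v0 vv' uv u'v' n; elim/ltn_ind: n => n IH nN.
have := etrans (uv n) (esym (u'v' n)); rewrite /fps_mul.
rewrite !big_ord_recr /= !subnn -(vv' 0%N) // v0 !mulr0 !addr0.
rewrite (eq_bigr (fun i : 'I_n => u' i * v' (n - i)%N)) => [|i _].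
  by rewrite vv' // => /addIr /addIr.
by rewrite IH ?vv' // (leq_trans _ nN) // ?leq_subr // ltnW.
Qed.

(** * Two pairs satisfying the relation: geometric and exponential *)

(** The series is x/(1 - c x), because (c x^2 d/dx)^k x = k! c^k x^(k+1). *)
Lemma op_exp_vfield1X c n :
  op_exp (vfield c 1) fpsX n = if n is m.+1 then c ^+ m else 0.
Proof.
have iterE k m : iter k (vfield c 1) fpsX m = k`!%:R * c ^+ k * (m == k.+1)%:R.
  elim: k m => [|k IH] m; first by rewrite !mul1r.
  rewrite iterS vfieldE IH factS natrM exprS.
  case: m => [|[|m]] /=; rewrite ?mulr0 // subSS subn0 !eqSS.
  by have [->|] := eqVneq m k; rewrite ?mulr0 //; ring.
rewrite op_exp_vfieldE //; under eq_bigr => k _ do rewrite iterE.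
case: n => [|n]; first by rewrite big_ord1 !mulr0.
rewrite big_ord_recr /= [X in _ + X]mulrA eqSS (ltn_eqF (ltnSn n)) mulr0 addr0.
rewrite big_ord_recr /= eqxx mulr1 mulKf ?pnatr_eq0 -?lt0n ?fact_gt0 //.
rewrite big1 ?add0r // => i _.
by rewrite eqSS gtn_eqF // !mulr0.
Qed.

(** For u = x/(1 - c x) and v = -x/(1 + c x), both u + v and -2 c u v equal 2 c x^2/(1 - c^2
    x^2). *)
Lemma moebius_rel_geometric c n :
  moebius_rel (2%:R * c) (op_exp (vfield c 1) fpsX)
    (fps_flip (op_exp (vfield c 1) fpsX)) n.
Proof.
set h := op_exp _ _; have hE m : h m = if m is l.+1 then c ^+ l else 0.
  exact: op_exp_vfield1X.
rewrite /moebius_rel /fps_flip fps_mulC /fps_mul hE.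
case: n => [|n]; first by rewrite big_ord1 hE !mulr0 !addr0.
(* Both extreme terms vanish because [h] has no constant term; the others share the power c^(n-1)
   and alternate in sign. *)
rewrite big_ord_recr big_ord_recl /= subnn !hE !mulr0 mul0r addr0 add0r.
rewrite (eq_bigr (fun i : 'I_n => - (-1) ^+ i * c ^+ n.-1)); last first.
  move=> i _; rewrite /= /bump /= !add1n !hE subSS -(subnSK (ltn_ord i)).
  rewrite exprS mulN1r -mulrA -exprD.
  by case: n i => [[]//|n] i; rewrite subSS subnKC // -ltnS.
rewrite -mulr_suml sumrN.
have -> : \sum_(i < n) (-1) ^+ i = (odd n)%:R :> K.
  elim: n => [|n IH]; first by rewrite big_ord0.
  by rewrite big_ord_recr /= IH -signr_odd; case: (odd n); rewrite ?subrr ?add0r.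
rewrite -signr_odd /=.
case: n => [|n] /=; first by rewrite !expr0 !expr1; ring.
by rewrite exprS; case: (odd n); rewrite /= ?expr1 ?expr0; ring.
Qed.

(** The binomial theorem for (a - a)^n / n!. *)
Lemma fps_mul_exp_flip a :
  fps_mul (fps_exp a) (fps_flip (fps_exp a)) = fps1.
Proof.
apply/funext => n.
transitivity ((a - a) ^+ n / n`!%:R); last first.
  by rewrite subrr expr0n /fps1; case: n => [|n]; rewrite ?mul0r // divr1.
rewrite addrC exprDn mulr_suml; apply: eq_bigr => i _.
have iln : (i <= n)%N by rewrite -ltnS.
rewrite /fps_flip /fps_exp -(bin_fact iln) !natrM (exprNn a) -[_ *+ 'C(n, i)]mulr_natr.
have b0 : 'C(n, i)%:R != 0 :> K by rewrite pnatr_eq0 -lt0n bin_gt0.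
have fact0 m : m`!%:R != 0 :> K by rewrite pnatr_eq0 -lt0n fact_gt0.
by field; rewrite b0 !fact0.
Qed.

(** With E = e^(a x), the flip of f is (1/E - 1)/a, and expanding (E - 1)(1/E - 1) = 2 - E - 1/E
    gives the relation. *)
Lemma moebius_rel_expm1 a : a != 0 ->
  let f := fps_scale a^-1 (fps_sub (fps_exp a) fps1) in
  forall n, moebius_rel a f (fps_flip f) n.
Proof.
move=> a0 f n; rewrite /moebius_rel.
have fE i : f i = a^-1 * (fps_exp a i - (i == 0%N)%:R) by [].
have gE i : fps_flip f i = a^-1 * (fps_flip (fps_exp a) i - (i == 0%N)%:R).
  by rewrite /fps_flip fE; case: i => [|i] /=; ring.
have one_mul u : \sum_(i < n.+1) (i == 0%N :> nat)%:R * u (n - i)%N = u n :> K.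
  rewrite big_ord_recl mul1r subn0 big1 ?addr0 // => i _.
  by rewrite mul0r.
have mul_one u : \sum_(i < n.+1) u i * (n - i == 0)%N%:R = u n :> K.
  have := fps_mulC u fps1; move/(congr1 (fun s => s n)).
  by rewrite /fps_mul /fps1 one_mul.
have -> : fps_mul f (fps_flip f) n = a^-1 * a^-1 *
    (fps_mul (fps_exp a) (fps_flip (fps_exp a)) n - fps_exp a n
     - fps_flip (fps_exp a) n + (n == 0%N)%:R).
  rewrite -[X in _ - X + _]one_mul -[X in _ - X - _ + _]mul_one.
  rewrite -(mul_one (fun i => (i == 0%N)%:R)) /fps_mul.
  rewrite -!sumrB -big_split mulr_sumr; apply: eq_bigr => i _ /=.
  by rewrite fE gE; ring.
rewrite fps_mul_exp_flip fE gE /fps1.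
by field.
Qed.

End CauchyProduct.

Theorem proposition2p5 (R : realType) (a : R[i]) (ha : a != 0) (b : nat -> R[i])
    (hb : inf_exp_prod_eq b fpsX (fps_scale a^-1 (fps_sub (fps_exp a) fps1))) :
  b 1%N = a / 2%:R /\ (forall j : nat, odd j -> (1 < j)%N -> b j = 0).
Proof.
set f := fps_scale _ _ in hb; have fE := (exp_prod_cvgE _ _ _).1 hb.
have b1 : b 1%N = a / 2%:R.
  (* Degree 2 sees only the first factor. *)
  have := fE 2; rewrite /= op_exp_vfield_next // mulr1 add0r => <-.
  rewrite /f /fps_scale /fps_sub /fps_exp /fps1 /= subr0.
  rewrite (_ : 2`! = 2)%N //.
  by field.
split=> // j oj j1.
pose b' j := if j == 1%N then b 1%N else (-1) ^+ j * b j.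
suff hb' : inf_exp_prod_eq b' fpsX f.
  have := inf_exp_prod_unique hb hb' (ltnW j1).
  rewrite /b' gtn_eqF // -signr_odd oj expr1 mulN1r => /eqP.
  by rewrite -addr_eq0 -mulr2n mulrn_eq0 => /eqP.
(* The induction starts after the first factor, where a = 2 b_1 gives the geometric pair; before it,
   x and -x do not satisfy the relation. This is why [b'] keeps the exponent of index 1. *)
have rel N n : moebius_rel a (exp_prod b' N.+1 fpsX)
    (fps_flip (exp_prod b N.+1 fpsX)) n.
  elim: N n => [|N IH] n.
    rewrite /= /b' /= (_ : a = 2%:R * b 1%N); first exact: moebius_rel_geometric.
    by rewrite b1; field.
  rewrite [exp_prod b' _ _]/= [exp_prod b _ _]/=.
  have -> : b' N.+2 = (-1) ^+ N.+2 * b N.+2 by [].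
  by rewrite op_exp_vfield_flip //; exact: moebius_rel_op_exp.
have stable (b0 : nat -> R[i]) N n : (n <= N.+1)%N ->
  exp_prod b0 N fpsX n = exp_prod b0 n.-1 fpsX n by exact: exp_prod_stable.
(* Passing to the partial product of index [n.+1] leaves the coefficient of x^n unchanged and
   reaches an index covered by [rel]. *)
apply/exp_prod_cvgE => n; rewrite -(stable b' n.+1) ?leqW //.
apply/esym/(moebius_rel_inj (N := n) _ _ (rel n) (moebius_rel_expm1 ha)) => //.
  by rewrite /fps_flip stable //= mulr0.
by move=> m mn; rewrite /fps_flip stable -?fE // (leq_trans mn) // leqW.
Qed.
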